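(* Let $y=A\xi\in\operatorname{ran}(A)$ with $\xi\in\mathbb R^n$, let $\{u^j\}_{j=1}^J$ solve the naive EKI dynamics $\dot u^j(t)=-C(t)A^T\Gamma^{-1}(Au^j(t)-y)$, $t\ge0$, where $m(t)=\frac1J\sum_ju^j(t)$ and $C(t)=\frac1J\sum_j(u^j(t)-m(t))(u^j(t)-m(t))^T$, and let $C_0=C(0)$. Let $S\in\mathbb R^{n\times n}$ be an invertible matrix such that $C_0A^T\Gamma^{-1}A=SDS^{-1}$ with $D=\operatorname{diag}(\mu_1,\dots,\mu_k,0,\dots,0)$, $\mu_1\ge\dots\ge\mu_k>0$. Then $$L(v):=\tfrac12\|S^{-1}(v-\xi)\|^2,\qquad v\in\mathbb R^n,$$ is a Lyapunov function for the dynamics of the sample mean $m(t)$, meaning that $\frac{d}{dt}L(m(t))\le0$ for all $t\ge0$.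
   Context: $A\in\mathbb R^{m\times n}$; $\Gamma\in\mathbb R^{m\times m}$ is symmetric positive definite; the initial sample covariance $C_0\in\mathbb R^{n\times n}$ is assumed symmetric positive definite. Under the dynamics, $\dot m=-CA^T\Gamma^{-1}(Am-y)$ and $\dot C=-2CA^T\Gamma^{-1}AC$. $\|\cdot\|$ is the Euclidean norm. A diagonalization as in the claim always exists. *)

(* Defs.v *)
From HB Require Import structures.
From mathcomp Require Import all_boot all_order all_algebra.
From mathcomp Require Import all_classical all_reals all_analysis.
Set Implicit Arguments.
Unset Strict Implicit.
Unset Printing Implicit Defensive.
Import Order.TTheory GRing.Theory Num.Theory.
Import numFieldNormedType.Exports.
Local Open Scope classical_set_scope.
Local Open Scope ring_scope.

(* The library norm on matrices is the max norm, hence a separate Euclidean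
   norm. *)
Definition enorm (R : realType) (n : nat) (v : 'cV[R]_n) : R :=
  Num.sqrt (\sum_(i < n) v i 0 ^+ 2).

Definition sym_posdef (R : realType) (n : nat) (M : 'M[R]_n) : Prop :=
  M \is symmetricmx /\
  forall v : 'cV[R]_n, v != 0 -> 0 < (v^T *m M *m v) 0 0.

(* "f'(t) = l" for f considered on [0, +oo[ only: the difference quotient runs
   over the s != t with 0 <= s, so this is the two-sided derivative for t > 0
   and the right derivative for t = 0; values of f at negative times are
   irrelevant. *)
Definition has_time_derivative (R : realType) (V : normedModType R)
    (f : R -> V) (t : R) (l : V) : Prop :=
  (s - t)^-1 *: (f s - f t) @[s --> within `[0, +oo[ t^'] --> l.

Definition sample_mean (R : realType) (J n : nat)
    (u : 'I_J -> R -> 'cV[R]_n) (t : R) : 'cV[R]_n :=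
  J%:R^-1 *: \sum_(j < J) u j t.

Definition sample_cov (R : realType) (J n : nat)
    (u : 'I_J -> R -> 'cV[R]_n) (t : R) : 'M[R]_n :=
  J%:R^-1 *: \sum_(j < J)
    ((u j t - sample_mean u t) *m (u j t - sample_mean u t)^T).

Definition solves_naive_EKI (R : realType) (m n J : nat) (A : 'M[R]_(m, n))
    (Gamma : 'M[R]_m) (y : 'cV[R]_m) (u : 'I_J -> R -> 'cV[R]_n) : Prop :=
  forall (j : 'I_J) (t : R), 0 <= t ->
    has_time_derivative (u j) t
      (- (sample_cov u t *m A^T *m invmx Gamma *m (A *m u j t - y))).

(* L along the curve x is differentiable on [0, +oo[ with derivative <= 0. *)
Definition lyapunov_along (R : realType) (n : nat) (L : 'cV[R]_n -> R)
    (x : R -> 'cV[R]_n) : Prop :=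
  forall t : R, 0 <= t ->
    exists2 l : R, has_time_derivative (V := R^o) (L \o x) t l & l <= 0.

(* Main.v *)
Require Import Defs.
From mathcomp Require Import all_boot all_order all_algebra.
From mathcomp Require Import all_classical all_reals all_analysis.

(* With B = A^T Gamma^-1 A, the Riccati equation C' = - 2 C B C has the solution
   C(t) = C_0 (1 + 2t B C_0)^-1, so C(t) B is diagonalized by the same S as
   C_0 B, with eigenvalues mu_i / (1 + 2t mu_i) >= 0. In the coordinates
   e = S^-1 (m - xi) the mean thus obeys e' = - N e with N diagonal and
   nonnegative, whence (|e|^2 / 2)' = - e^T N e <= 0. Uniqueness for the Riccati
   equation is only needed after multiplication by A, where it follows from an
   energy estimate: w' = - K G w with K >= 0 makes w^T G w nonincreasing. *)

Set Implicit Arguments.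
Unset Strict Implicit.
Unset Printing Implicit Defensive.
Import Order.TTheory GRing.Theory Num.Theory.
Import numFieldNormedType.Exports.
Local Open Scope ring_scope.

(** * Entrywise convergence of matrix-valued functions *)

Lemma cvg_mxP {R : realType} {T : Type} {F : set_system T} {FF : Filter F}
    {p q : nat} (f : T -> 'M[R]_(p, q)) (L : 'M[R]_(p, q)) :
  (f x @[x --> F] --> L)%classic <->
  forall i j, (f x i j @[x --> F] --> L i j)%classic.
Proof.
split=> [fL i j|fL].
  exact: (cvg_comp _ _ fL (@coord_continuous R p q i j L)).
apply/cvgrPdist_lt => e e0.
(* There are finitely many index pairs, so the entrywise bounds hold simultaneously; for the max
   norm they say that [f x] lies in the [e]-ball around [L]. *)
have /filter_forall H : forall ij : 'I_p * 'I_q,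
    F [set x | `|L ij.1 ij.2 - f x ij.1 ij.2| < e]%classic.
  by move=> [i j]; have /cvgrPdist_lt := fL i j; exact.
apply: filterS H => x H.
have : ball L e (f x) by split=> // i j; exact: (H (i, j)).
by rewrite -ball_normE.
Qed.

Lemma cvg_mulmx {R : realType} {T : Type} {F : set_system T} {FF : Filter F}
    {p q r : nat} (f : T -> 'M[R]_(p, q)) (g : T -> 'M[R]_(q, r))
    (a : 'M[R]_(p, q)) (b : 'M[R]_(q, r)) :
  (f x @[x --> F] --> a)%classic -> (g x @[x --> F] --> b)%classic ->
  (f x *m g x @[x --> F] --> a *m b)%classic.
Proof.
move=> /cvg_mxP fa /cvg_mxP gb; apply/cvg_mxP => i j.
rewrite mxE; under eq_fun do rewrite mxE.
by apply: cvg_big => [|k _]; [exact: add_continuous|exact: cvgM].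
Qed.

(** * Calculus of derivatives on the closed half-line *)

Section TimeDerivative.
Context {R : realType}.

Section NormedModule.
Context {V : normedModType R}.
Implicit Types (f g : R -> V) (t : R) (l : V).

Lemma has_time_derivative_cvg f t l : has_time_derivative f t l ->
  (f s @[s --> within `[0, +oo[ t^'] --> f t)%classic.
Proof.
move=> fl.
(* [f] is rebuilt from its difference quotient, which converges and is multiplied by [s - t],
   tending to 0. *)
rewrite (_ : f = fun s => f t + (s - t) *: ((s - t)^-1 *: (f s - f t))); last first.
  apply/funext => s; have [->|st] := eqVneq s t.
    by rewrite !subrr scale0r addr0.
  by rewrite scalerA mulfV ?subr_eq0// scale1r addrC subrK.
rewrite [X in (_ --> X)%classic](_ : _ = f t + (t - t) *: l); last first.
  by rewrite subrr !scale0r !addr0.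
apply: cvgD; first exact: cvg_cst.
apply: cvgZ fl; apply: cvgB; last exact: cvg_cst.
apply: cvg_trans; first exact: cvg_within.
exact: cvg_within.
Qed.

Lemma has_time_derivative_cst (c : V) t : has_time_derivative (fun=> c) t 0.
Proof.
rewrite /has_time_derivative.
under eq_fun do rewrite subrr scaler0.
exact: cvg_cst.
Qed.

Lemma has_time_derivativeD f g t l l' :
  has_time_derivative f t l -> has_time_derivative g t l' ->
  has_time_derivative (fun s => f s + g s) t (l + l').
Proof.
move=> fl gl; rewrite /has_time_derivative.
under eq_fun do rewrite opprD addrACA scalerDr.
exact: cvgD.
Qed.

Lemma has_time_derivative_sum (I : finType) (f : I -> R -> V) t (l : I -> V) :
  (forall i, has_time_derivative (f i) t (l i)) ->
  has_time_derivative (fun s => \sum_i f i s) t (\sum_i l i).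
Proof.
move=> fl; rewrite /has_time_derivative.
under eq_fun do rewrite -sumrB scaler_sumr.
by apply: cvg_big => [|i _]; [exact: add_continuous|exact: fl].
Qed.

Lemma has_time_derivativeZ (a : R) f t l :
  has_time_derivative f t l -> has_time_derivative (fun s => a *: f s) t (a *: l).
Proof.
move=> fl; rewrite /has_time_derivative.
under eq_fun do rewrite -scalerBr scalerA mulrC -scalerA.
by apply: cvgZ fl; exact: cvg_cst.
Qed.

Lemma has_time_derivative_scale (c : V) t :
  has_time_derivative (fun s => s *: c) t c.
Proof.
rewrite /has_time_derivative.
apply: cvg_near_cst.
rewrite near_withinE; near=> s => _.
rewrite -scalerBl scalerA mulVf ?scale1r// subr_eq0.
near: s; exact: nbhs_dnbhs_neq.
Unshelve. all: by end_near. Qed.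

End NormedModule.

Lemma has_time_derivative_mulmx {p q r : nat} (f : R -> 'M[R]_(p, q))
    (g : R -> 'M[R]_(q, r)) (t : R) (l : 'M[R]_(p, q)) (l' : 'M[R]_(q, r)) :
  has_time_derivative f t l -> has_time_derivative g t l' ->
  has_time_derivative (fun s => f s *m g s) t (l *m g t + f t *m l').
Proof.
move=> fl gl; rewrite /has_time_derivative.
(* Splitting of the product increment; its first term also uses the continuity of [g] at [t]. *)
rewrite (_ : (fun s => _) = fun s => ((s - t)^-1 *: (f s - f t)) *m g s +
    f t *m ((s - t)^-1 *: (g s - g t))); last first.
  apply/funext => s.
  by rewrite -scalemxAl -scalemxAr -scalerDr mulmxBl mulmxBr addrA subrK.
apply: cvgD; apply: cvg_mulmx => //; last exact: cvg_cst.
exact: has_time_derivative_cvg gl.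
Qed.

Lemma has_time_derivative_mulmxl {p q r : nat} (M : 'M[R]_(p, q))
    (g : R -> 'M[R]_(q, r)) (t : R) (l : 'M[R]_(q, r)) :
  has_time_derivative g t l ->
  has_time_derivative (fun s => M *m g s) t (M *m l).
Proof.
move=> gl; have := has_time_derivative_mulmx (has_time_derivative_cst M t) gl.
by rewrite mul0mx add0r.
Qed.

Lemma has_time_derivative_mulmxr {p q r : nat} (f : R -> 'M[R]_(p, q))
    (M : 'M[R]_(q, r)) (t : R) (l : 'M[R]_(p, q)) :
  has_time_derivative f t l ->
  has_time_derivative (fun s => f s *m M) t (l *m M).
Proof.
move=> fl; have := has_time_derivative_mulmx fl (has_time_derivative_cst M t).
by rewrite mulmx0 addr0.
Qed.

Lemma has_time_derivative_trmx {p q : nat} (f : R -> 'M[R]_(p, q)) (t : R)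
    (l : 'M[R]_(p, q)) :
  has_time_derivative f t l -> has_time_derivative (fun s => (f s)^T) t l^T.
Proof.
move=> /cvg_mxP fl; apply/cvg_mxP => i j.
rewrite mxE; under eq_fun do rewrite !mxE.
by have := fl j i; under eq_fun do rewrite !mxE.
Qed.

Lemma has_time_derivative_coord {p q : nat} (f : R -> 'M[R]_(p, q)) (t : R)
    (l : 'M[R]_(p, q)) i j :
  has_time_derivative f t l ->
  has_time_derivative (V := R^o) (fun s => f s i j) t (l i j).
Proof.
by move=> /cvg_mxP /(_ i j); under eq_fun do rewrite !mxE.
Qed.

(** For [t > 0] all small shifts of [t] stay in the half-line, so the restriction to nonnegative
    times is invisible. This gives access to monotonicity criteria stated with [derivable]. *)
Lemma has_time_derivative_derive1 (f : R -> R) (t l : R) : 0 < t ->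
  has_time_derivative (V := R^o) f t l ->
  derivable f t 1 /\ (f^`() t)%classic = l.
Proof.
move=> t0 fl.
have tF : (h + t @[h --> (0 : R)^'] --> within `[0, +oo[ t^')%classic.
  move=> P /= /nbhs_ballP[e /= e0 eP].
  (* The radius is capped at [t] so that [|h| < t] forces [0 <= h + t]. *)
  apply/nbhs_ballP; exists (Num.min e t) => /=; first by rewrite lt_min e0.
  move=> h /=; rewrite /ball /= sub0r normrN lt_min => /andP[he ht] h0.
  apply: eP => //=.
  - by rewrite /ball /= opprD addrCA subrr addr0 normrN.
  - by rewrite -subr_eq0 addrK.
  - rewrite in_itv/= andbT -lerBlDr sub0r.
    by move: ht; rewrite ltr_norml => /andP[/ltW].
have H : (h^-1 *: (f (h + t) - f t) @[h --> 0^'] --> (l : R^o))%classic.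
  have := cvg_comp _ _ tF fl; rewrite /comp.
  by under eq_fun do rewrite addrK.
split; last exact: cvg_lim H.
by apply/cvg_ex; exists l; under eq_fun do rewrite /= [_ *: 1]mulr1.
Qed.

(** The sign of the derivative is used on the open half-line, together with continuity up to the
    endpoint 0, which the right derivative there provides. *)
Lemma has_time_derivative_le0 (f f' : R -> R) :
  (forall t, 0 <= t -> has_time_derivative (V := R^o) f t (f' t)) ->
  (forall t, 0 <= t -> f' t <= 0) ->
  forall t, 0 <= t -> f t <= f 0.
Proof.
move=> fE f'0 t t0.
apply: (@ler0_derive1_nincry R f 0) => // [x|x|].
- rewrite in_itv/= andbT => x0.
  by have [] := has_time_derivative_derive1 x0 (fE x (ltW x0)).
- rewrite in_itv/= andbT => x0.
  have [_ ->] := has_time_derivative_derive1 x0 (fE x (ltW x0)).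
  exact/f'0/ltW.
- apply/subspace_continuousP => x /=; rewrite in_itv/= andbT => x0.
  have /cvgrPdist_lt fx := has_time_derivative_cvg (fE x x0).
  apply/cvgrPdist_lt => e e0; have := fx e e0.
  rewrite !near_withinE; apply: filterS => s H xs.
  (* The derivative filter is punctured at [x], whereas continuity also asks about [s = x]. *)
  have [->|sx] := eqVneq s x; first by rewrite subrr normr0.
  exact: H.
Qed.

End TimeDerivative.

(** * Positive definite matrices and an energy estimate *)

Lemma sym_posdef_tr {R : realType} {p : nat} {M : 'M[R]_p} :
  sym_posdef M -> M^T = M.
Proof.
by move=> [/is_hermitianmxP MT _]; rewrite {2}MT expr0 scale1r map_mx_id.
Qed.

Lemma sym_posdef_unitmx {R : realType} {p : nat} {M : 'M[R]_p} :
  sym_posdef M -> M \in unitmx.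
Proof.
move=> [_ Mpos]; rewrite unitmxE unitfE; apply/det0P => -[v v0 vM].
have := Mpos v^T; rewrite trmxK vM mul0mx mxE ltxx => H.
by suff : false by []; apply: H; rewrite trmx_eq0.
Qed.

Lemma sym_posdef_invmx {R : realType} {p : nat} {M : 'M[R]_p} :
  sym_posdef M -> sym_posdef (invmx M).
Proof.
move=> Mpd; have MT := sym_posdef_tr Mpd; have Mu := sym_posdef_unitmx Mpd.
have iMT : (invmx M)^T = invmx M by rewrite trmx_inv MT.
split; first by apply/is_hermitianmxP; rewrite expr0 scale1r map_mx_id// iMT.
(* For [x = M^-1 v], which is nonzero, [x^T M x = v^T M^-1 v]. *)
move=> v v0; have := Mpd.2 (invmx M *m v).
rewrite trmx_mul iMT -!mulmxA mulKVmx//; apply.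
by apply: contra_neq v0 => v0; rewrite -(mulKVmx Mu v) v0 mulmx0.
Qed.

(* The energy [w^T G w] is nonincreasing along the flow and starts at [0]. *)
Lemma preconditioned_flow_eq0 {R : realType} {p : nat} (G : 'M[R]_p)
    (K : R -> 'M[R]_p) (w : R -> 'cV[R]_p) :
  sym_posdef G ->
  (forall t, 0 <= t -> forall v : 'cV_p, 0 <= (v^T *m K t *m v) 0 0) ->
  (forall t, 0 <= t -> has_time_derivative w t (- (K t *m G *m w t))) ->
  w 0 = 0 -> forall t, 0 <= t -> w t = 0.
Proof.
move=> Gpd Kpsd wE w0 t t0; have GT := sym_posdef_tr Gpd.
pose f s := ((w s)^T *m (G *m w s)) 0 0.
pose f' s := (- (K s *m G *m w s))^T *m (G *m w s) +
  (w s)^T *m (G *m (- (K s *m G *m w s))).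
have fE s : 0 <= s -> has_time_derivative (V := R^o) f s (f' s 0 0).
  move=> s0; apply: has_time_derivative_coord.
  apply: has_time_derivative_mulmx; first exact: has_time_derivative_trmx (wE s s0).
  exact: has_time_derivative_mulmxl (wE s s0).
have f'0 s : 0 <= s -> f' s 0 0 <= 0.
  move=> s0; set x := G *m w s.
  (* By symmetry of [G] both product-rule terms become [- x^T K x], one of them transposed; as 1x1
     matrices they have the same entry. *)
  have E : f' s = - (x^T *m K s *m x)^T - x^T *m K s *m x.
    rewrite /f' linearN /= 2!mulmxN mulNmx /x !trmx_mul !trmxK GT.
    by rewrite !mulmxA.
  have := Kpsd s s0 x; rewrite E; move: (_ *m x) => z z0.
  by rewrite !mxE -opprD oppr_le0 addr_ge0.
have := has_time_derivative_le0 fE f'0 t0.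
rewrite {2}/f w0 !mulmx0 mxE leNgt; apply: contraNeq => wt0.
by rewrite /f mulmxA; exact: Gpd.2.
Qed.

(** * Evolution of the sample mean and the sample covariance *)

Section NaiveEKI.
Context {R : realType} {m n J : nat}.
Context (A : 'M[R]_(m, n)) (Gamma : 'M[R]_m) (y : 'cV[R]_m).
Context (u : 'I_J -> R -> 'cV[R]_n).

Let C := sample_cov u.
Let B := A^T *m invmx Gamma *m A.

Lemma sample_cov_tr t : (C t)^T = C t.
Proof.
rewrite /C /sample_cov linearZ /= linear_sum /=; congr (_ *: _).
by apply: eq_bigr => j _; rewrite trmx_mul trmxK.
Qed.

Lemma sample_cov_ge0 t (v : 'cV[R]_n) : 0 <= (v^T *m C t *m v) 0 0.
Proof.
rewrite /C /sample_cov -scalemxAr -scalemxAl mulmx_sumr mulmx_suml mxE.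
apply: mulr_ge0; first by rewrite invr_ge0 ler0n.
rewrite summxE; apply: sumr_ge0 => j _; set d := u j t - _.
have -> : v^T *m (d *m d^T) *m v = (v^T *m d) *m (v^T *m d)^T.
  by rewrite trmx_mul trmxK !mulmxA.
by rewrite mxE big_ord1 [_^T _ _]mxE -expr2 sqr_ge0.
Qed.

Context (J0 : (0 < J)%N) (Gamma_pd : sym_posdef Gamma).
Context (usol : solves_naive_EKI A Gamma y u).

Let B_tr : B^T = B.
Proof.
by rewrite /B !trmx_mul trmxK (sym_posdef_tr (sym_posdef_invmx Gamma_pd)) mulmxA.
Qed.

(** The drift is affine in [u j] with the same matrix [C t] for every particle, so it commutes with
    averaging; [J > 0] makes the average of the constant [y] equal to [y]. *)
Lemma sample_mean_derivative t : 0 <= t ->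
  has_time_derivative (sample_mean u) t
    (- (C t *m A^T *m invmx Gamma *m (A *m sample_mean u t - y))).
Proof.
move=> t0; set P := C t *m A^T *m invmx Gamma.
have -> : - (P *m (A *m sample_mean u t - y)) =
    J%:R^-1 *: \sum_j - (P *m (A *m u j t - y)).
  rewrite sumrN scalerN -mulmx_sumr scalemxAr sumrB sumr_const card_ord.
  rewrite scalerBr -[y *+ J]scaler_nat scalerA mulVf ?pnatr_eq0 -?lt0n// scale1r.
  by rewrite -mulmx_sumr scalemxAr.
by apply/has_time_derivativeZ/has_time_derivative_sum => j; exact: usol.
Qed.

(** The data [y] cancels in the deviations, which solve [d' = - C B d]. The product rule on [d d^T],
    averaged, gives [- C B C - C (C B)^T], and [B] and [C] are symmetric. *)
Lemma sample_cov_derivative t : 0 <= t ->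
  has_time_derivative C t (- (2 *: (C t *m B *m C t))).
Proof.
move=> t0.
pose d j s := u j s - sample_mean u s.
have dE j : has_time_derivative (d j) t (- (C t *m B *m d j t)).
  have -> : - (C t *m B *m d j t) =
      - (C t *m A^T *m invmx Gamma *m (A *m u j t - y)) +
      - 1 *: - (C t *m A^T *m invmx Gamma *m (A *m sample_mean u t - y)).
    rewrite scaleN1r -opprD -mulmxBr opprB addrA subrK -mulmxBr.
    by rewrite /B !mulmxA.
  rewrite (_ : d j = fun s => u j s + - 1 *: sample_mean u s); last first.
    by apply/funext => s; rewrite scaleN1r.
  apply: has_time_derivativeD; first exact: usol.
  by apply: has_time_derivativeZ; exact: sample_mean_derivative.
have -> : - (2 *: (C t *m B *m C t)) = J%:R^-1 *:
    \sum_j (- (C t *m B *m d j t) *m (d j t)^T +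
            d j t *m (- (C t *m B *m d j t))^T).
  (* The factor [C t *m B] is common to all particles; pulling it out leaves sums that average to
     [C t]. *)
  rewrite [X in _ = _ *: X](_ : _ = - (C t *m B *m \sum_j d j t *m (d j t)^T) -
      (\sum_j d j t *m (d j t)^T) *m (C t *m B)^T); last first.
    rewrite mulmx_sumr mulmx_suml -!sumrN -big_split /=; apply: eq_bigr => j _.
    by rewrite linearN /= trmx_mul mulNmx mulmxN !mulmxA.
  set X := \sum_j _; have XE : J%:R^-1 *: X = C t by [].
  rewrite scalerBr scalerN [_ *: (_ *m X)]scalemxAr [_ *: (X *m _)]scalemxAl XE.
  by rewrite trmx_mul B_tr sample_cov_tr (mulmxA _ B) -opprD scaler_nat mulr2n.
apply/has_time_derivativeZ/has_time_derivative_sum => j.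
apply: has_time_derivative_mulmx; first exact: dE.
exact: has_time_derivative_trmx (dE j).
Qed.

(* The defect [Z = C (1 + 2t B C 0) - C 0] satisfies [Z' = - 2 C B Z], so each
   column of [A Z] follows the flow of [preconditioned_flow_eq0] with
   [K = 2 A C A^T]; transposing [A Z = 0] gives the statement. *)
Lemma sample_cov_implicit t : 0 <= t ->
  (1%:M + t *: (2 *: (C 0 *m B))) *m (C t *m B) = C 0 *m B.
Proof.
move=> t0; pose Q s := 1%:M + s *: (2 *: (B *m C 0)).
have QE s : has_time_derivative Q s (2 *: (B *m C 0)).
  rewrite -[X in has_time_derivative _ _ X]add0r.
  apply: has_time_derivativeD; first exact: has_time_derivative_cst.
  exact: has_time_derivative_scale.
pose Z s := C s *m Q s + - C 0.
have ZE s : 0 <= s -> has_time_derivative Z s (- (2 *: (C s *m B *m Z s))).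
  (* Since [Q' = 2 B C 0], the product rule gives [- 2 C B C Q + 2 C B C 0], which is
     [- 2 C B (C Q - C 0)]. *)
  move=> s0; have -> : - (2 *: (C s *m B *m Z s)) =
      - (2 *: (C s *m B *m C s)) *m Q s + C s *m (2 *: (B *m C 0)) + 0.
    rewrite /Z; move: (Q s) (C s) (B) (C 0) => q c b c0.
    rewrite mulmxBr scalerBr opprB addr0 addrC mulNmx.
    by rewrite -scalemxAl -scalemxAr !mulmxA.
  apply: has_time_derivativeD; last exact: has_time_derivative_cst.
  apply: has_time_derivative_mulmx; last exact: QE.
  exact: sample_cov_derivative.
have AZ0 : A *m Z t = 0.
  apply/matrixP => i j; pose v : 'cV[R]_n := delta_mx j 0.
  (* Column [j] of [A Z]. As [B = A^T Gamma^-1 A], it satisfies [w' = - (2 A C A^T) Gamma^-1 w]: the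
     flow closes on [w]. *)
  pose w s := A *m Z s *m v.
  suff : w t = 0 by move/matrixP/(_ i 0); rewrite /w /v -colE !mxE.
  apply: (@preconditioned_flow_eq0 _ _ (invmx Gamma)
    (fun s => 2 *: (A *m C s *m A^T)) w) => //.
  - exact: sym_posdef_invmx.
  - move=> s s0 x; rewrite -scalemxAr -scalemxAl mxE mulr_ge0//.
    have := sample_cov_ge0 s (A^T *m x).
    by rewrite trmx_mul trmxK !mulmxA.
  - move=> s s0; rewrite (_ : - _ = A *m - (2 *: (C s *m B *m Z s)) *m v).
      exact/has_time_derivative_mulmxr/has_time_derivative_mulmxl/ZE.
    rewrite /w /B; move: (C s) (Z s) => c z.
    by rewrite mulmxN mulNmx -scalemxAr -!scalemxAl !mulmxA.
  - by rewrite /w /Z /Q scale0r addr0 mulmx1 subrr mulmx0 mul0mx.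
have QT : (Q t)^T = 1%:M + t *: (2 *: (C 0 *m B)).
  rewrite /Q; have := sample_cov_tr 0; move: (C 0) => c0 c0T; rewrite !scalerA.
  by rewrite linearD /= trmx1 linearZ /= trmx_mul B_tr c0T.
move: AZ0; rewrite /Z mulmxBr => /subr0_eq /(congr1 trmx).
rewrite !trmx_mul !sample_cov_tr QT => E.
(* [B] starts with [A^T], so the transposed identity [Q^T C A^T = C 0 A^T] extends to [B] by right
   multiplication with [Gamma^-1 A]. *)
have BE (X : 'M[R]_n) : X *m B = X *m A^T *m (invmx Gamma *m A).
  by rewrite /B !mulmxA.
by rewrite (mulmxA _ (C t)) (BE (_ *m C t)) E -BE.
Qed.

End NaiveEKI.

(** * Diagonalization and decay of the Lyapunov function *)

(** Conjugation by [S] turns the equation into [(1 + c D) N = D], that is [(1 + c d_i) N_ij = D_ij],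
    and the scalars on the left are invertible. *)
Lemma diag_mx_resolvent {R : realType} {n : nat} (S X : 'M[R]_n)
    (d : 'rV[R]_n) (c : R) :
  S \in unitmx -> (forall i, 1 + c * d 0 i != 0) ->
  (1%:M + c *: (S *m diag_mx d *m invmx S)) *m X = S *m diag_mx d *m invmx S ->
  invmx S *m X *m S = diag_mx (\row_i (d 0 i / (1 + c * d 0 i))).
Proof.
move=> Su den0 /(congr1 (fun Y => invmx S *m Y *m S)); set N := _ *m X *m S.
rewrite mulmxDl mul1mx mulmxDr mulmxDl -scalemxAl -scalemxAr -scalemxAl.
rewrite -!mulmxA mulVmx// mulmx1 !mulKmx// [invmx S *m _]mulmxA -/N.
move=> NE; apply/matrixP => i j; move/matrixP/(_ i j): NE.
rewrite mul_diag_mx !mxE => NE.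
apply: (mulfI (den0 i)); rewrite mulrDl mul1r -mulrA NE.
by case: (i == j); rewrite ?mulr0// !mulr1n mulrC divfK.
Qed.

Theorem proposition4p3 (R : realType) (m n J k : nat)
    (A : 'M[R]_(m, n)) (Gamma : 'M[R]_m) (y : 'cV[R]_m) (xi : 'cV[R]_n)
    (u : 'I_J -> R -> 'cV[R]_n) (S : 'M[R]_n) (mu : k.-tuple R) :
  (0 < J)%N ->
  sym_posdef Gamma ->
  y = A *m xi ->
  solves_naive_EKI A Gamma y u ->
  sym_posdef (sample_cov u 0) ->
  S \in unitmx ->
  (k <= n)%N ->
  (forall i j : 'I_k, (i <= j)%N -> tnth mu j <= tnth mu i) ->
  (forall i : 'I_k, 0 < tnth mu i) ->
  (* entries with index >= k are 0, the default value of the lookup *)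
  sample_cov u 0 *m A^T *m invmx Gamma *m A =
    S *m diag_mx (\row_(i < n) mu`_i) *m invmx S ->
  lyapunov_along (fun v => 2^-1 * enorm (invmx S *m (v - xi)) ^+ 2)
    (sample_mean u).
Proof.
move=> J0 Gpd yE usol _ Su kn _ mu0 C0E t t0.
pose d := \row_(i < n) mu`_i : 'rV[R]_n.
pose C := sample_cov u; pose B := A^T *m invmx Gamma *m A.
have d0 i : 0 <= d 0 i.
  rewrite mxE; have [ik|ki] := ltnP i k; last by rewrite nth_default ?size_tuple.
  by have := mu0 (Ordinal ik); rewrite (tnth_nth 0) => /ltW.
have den0 i : 0 < 1 + t * 2 * d 0 i.
  by rewrite ltr_wpDr// !mulr_ge0.
(* [C t *m B] in the eigenbasis of [C 0 *m B]; the resolvent lemma applies with [c = 2t]. *)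
pose N := invmx S *m (C t *m B) *m S.
have NE : N = diag_mx (\row_i (d 0 i / (1 + t * 2 * d 0 i))).
  apply: diag_mx_resolvent => // [i|]; first by rewrite gt_eqF.
  have <- : C 0 *m B = S *m diag_mx d *m invmx S by rewrite -C0E /B !mulmxA.
  rewrite -scalerA; exact: (sample_cov_implicit (y := y)).
pose e s := invmx S *m (sample_mean u s - xi).
have eE : has_time_derivative e t (- (N *m e t)).
  (* With [y = A xi] the drift of the mean is [- C B (m - xi)]; the trailing 0 is the derivative of
     the constant [- xi]. *)
  have -> : - (N *m e t) =
      invmx S *m (- (C t *m A^T *m invmx Gamma *m (A *m sample_mean u t - y)) + 0).
    rewrite addr0 yE -mulmxBr /N /e mulmxN; congr (- _).
    by rewrite -!mulmxA mulKVmx// /B !mulmxA.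
  apply: has_time_derivative_mulmxl.
  apply: has_time_derivativeD; last exact: has_time_derivative_cst.
  exact: sample_mean_derivative.
(* Along the mean, [L] is half the single entry of [e^T e], a form to which the product rule
   applies. *)
have -> : ((fun v => 2^-1 * enorm (invmx S *m (v - xi)) ^+ 2) \o sample_mean u) =
    (fun s => 2^-1 *: (((e s)^T *m e s) 0 0 : R^o)).
  apply/funext => s /=; rewrite /enorm sqr_sqrtr; last first.
    by apply: sumr_ge0 => i _; exact: sqr_ge0.
  by congr (_ * _); rewrite mxE; apply: eq_bigr => i _; rewrite expr2 [_^T _ _]mxE.
exists (2^-1 * ((- (N *m e t))^T *m e t + (e t)^T *m - (N *m e t)) 0 0).
  apply: has_time_derivativeZ; apply: has_time_derivative_coord.
  by apply: has_time_derivative_mulmx => //; exact: has_time_derivative_trmx.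
(* Since [N] is diagonal, this is a sum of squares [e_i^2] with nonnegative weights. *)
have H : 0 <= ((e t)^T *m (N *m e t)) 0 0.
  rewrite NE; move: (e t) => x; rewrite mxE sumr_ge0// => i _.
  rewrite mul_diag_mx mxE mxE [_ 0 i]mxE mulrCA -expr2 mulr_ge0 ?sqr_ge0//.
  by rewrite divr_ge0// ltW.
(* The two product-rule terms are transposes of each other, so both have the entry [- e^T N e]. *)
have -> : (- (N *m e t))^T *m e t = ((e t)^T *m - (N *m e t))^T.
  by rewrite trmx_mul trmxK.
rewrite pmulr_rle0 ?invr_gt0// mulmxN; move: (_ *m _) H => X X0.
by rewrite linearN /= !mxE -opprD oppr_le0 addr_ge0.
Qed.
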